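(* Let $\tilde\psi_h\in\tilde V_h$ be a continuous piecewise linear finite element phase-field on a mesh $\mathcal{T}_h$ satisfying $$\frac{1}{|K|}\int_K\tilde\psi_h\,dx\in[-1,1]\qquad\forall K\in\mathcal{T}_h .$$ Then the FEM-L scheme is bound preserving, i.e. the limited phase-field $\Pi_{ML}\,\Pi_s[\tilde\psi_h]\in\tilde V_h$, obtained by viewing $\tilde\psi_h$ as an element of the discontinuous space $V_h$, applying the elementwise scaling limiter $\Pi_s$ with bounds $\psi_{\min}=-1$, $\psi_{\max}=1$, and projecting back to $\tilde V_h$ with the mass-lumped projection $\Pi_{ML}$, satisfies $$\big\|\Pi_{ML}\,\Pi_s[\tilde\psi_h]\big\|_{L^\infty(\mathcal{T}_h)}\le 1 .$$
   Context: $\mathcal{T}_h$ is a conforming partition of a domain $\Omega$ into convex polygonal elements $K$. $V_h=\{\varphi\in L^2(\Omega):\varphi|_K\in\mathbb{P}^1(K)\ \forall K\in\mathcal{T}_h\}$ and $\tilde V_h=\{\varphi\in H^1(\Omega):\varphi|_K\in\mathbb{P}^1(K)\ \forall K\in\mathcal{T}_h\}\subset V_h$, where $\mathbb{P}^1(K)$ is the space of affine functions on $K$. $\tilde V_h$ is spanned by the Lagrange basis $\{\varphi_i\}_{i=1}^N$ with $\varphi_i(\mathbf{x}_j)=\delta_{ij}$, where the nodes $\mathbf{x}_1,\dots,\mathbf{x}_N$ are the mesh vertices. Scaling limiter $\Pi_s:V_h\to V_h$: for $\psi_h\in V_h$ and $K\in\mathcal{T}_h$ write $\psi_K=\psi_h|_K$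 and $\overline{\psi_K}=\frac1{|K|}\int_K\psi_K\,dx$. Then $\Pi_s[\psi_h]|_K=\alpha_K(\psi_K-\overline{\psi_K})+\overline{\psi_K}$, with $$\alpha_K=\min_{\mathbf{x}\in\Lambda_K}\Big\{1,\ \Big|\frac{\overline{\psi_K}-\psi_{\min}}{\overline{\psi_K}-\psi_K(\mathbf{x})}\Big|,\ \Big|\frac{\overline{\psi_K}-\psi_{\max}}{\overline{\psi_K}-\psi_K(\mathbf{x})}\Big|\Big\},$$ where points with $\psi_K(\mathbf{x})=\overline{\psi_K}$ impose no restriction, $\psi_{\min}=-1$, $\psi_{\max}=1$, and, for affine $\psi_K$, $\Lambda_K$ is the set of vertices of $K$. Mass-lumped projection $\Pi_{ML}:V_h\to\tilde V_h$, $\psi_h\mapsto\tilde\psi$: defined by $\langle\psi_h,w\rangle_{ML}=\langle\tilde\psi,w\rangle_{ML}$ for all $w\in\tilde V_h$, where $$\langle f,g\rangle_{ML}=\sum_{K\in\mathcal{T}_h}\frac{|K|}{C_K}\sum_{\mathbf{x}_i\in K} f|_K(\mathbf{x}_i)\,g|_K(\mathbf{x}_i)$$ and $C_K$ is the number of vertices of $K$. FEM-L scheme: after each time step the continuous finite element solution $\tilde\psi_h$ of the Cahn–Hilliard system is replaced by $\Pi_{ML}\Pi_s[\tilde\psi_h]$ (the embedding $\tilde V_h\subset V_h$ being exact). *)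

(* Defs.v *)
From mathcomp Require Import all_boot all_order all_algebra.
From mathcomp Require Import all_classical all_reals all_analysis.

Set Implicit Arguments.
Unset Strict Implicit.
Unset Printing Implicit Defensive.

Import Order.TTheory GRing.Theory Num.Theory.
Import numFieldNormedType.Exports.

Local Open Scope classical_set_scope.
Local Open Scope ring_scope.


(* [measurableTypeR R] is convertible to [R]; it carries the Borel structure on
   which [lebesgue_measure] is defined. *)
Definition leb2 (R : realType) :
    {measure set (measurableTypeR R * measurableTypeR R)%type -> \bar R} :=
  (@lebesgue_measure R \x @lebesgue_measure R)%E.

Definition domain (R : realType) (Omega : set (R * R)) : Prop :=
  [/\ open Omega, connected Omega & Omega !=set0].

Section Sobolev.
Variable R : realType.
Implicit Types (Omega : set (R * R)) (f g eta : R * R -> R) (v : R * R).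

Definition e1 : R * R := (1, 0).
Definition e2 : R * R := (0, 1).

Fixpoint Ck (k : nat) f : Prop :=
  if k is k'.+1 then
    [/\ continuous f,
        forall x, derivable f x e1 /\ derivable f x e2,
        Ck k' (fun x => 'D_e1 f x) & Ck k' (fun x => 'D_e2 f x)]
  else continuous f.

Definition test_function Omega eta : Prop :=
  [/\ forall k, Ck k eta,
      compact (closure [set x | eta x != 0]) &
      closure [set x | eta x != 0] `<=` Omega].

Definition L2 Omega f : Prop := (f \_ Omega) \in Lfun (leb2 R) 2%:E.

Definition weak_derivative Omega v f g : Prop :=
  forall eta, test_function Omega eta ->
    \int[leb2 R]_(x in Omega) (f x * 'D_v eta x) =
    - \int[leb2 R]_(x in Omega) (g x * eta x).

Definition H1 Omega f : Prop :=
  [/\ L2 Omega f,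
      exists2 g, L2 Omega g & weak_derivative Omega e1 f g &
      exists2 g, L2 Omega g & weak_derivative Omega e2 f g].

End Sobolev.

(* The convex hull of the points [x i], [i] in [V]. *)
Definition hull (R : realType) (N : nat) (x : 'I_N -> R * R) (V : {set 'I_N}) :
    set (R * R) :=
  [set y | exists t : 'I_N -> R,
     [/\ forall i, 0 <= t i, \sum_(i in V) t i = 1 &
         y = (\sum_(i in V) t i * (x i).1, \sum_(i in V) t i * (x i).2)]].

(* The nodes are the mesh vertices; an element is given by the set of indices
   of its vertices. *)
Record mesh (R : realType) := Mesh {
  nnode : nat;
  nelt : nat;
  node : 'I_nnode -> R * R;
  vtx : 'I_nelt -> {set 'I_nnode} }.

Section Mesh.
Variables (R : realType) (Omega : set (R * R)) (T : mesh R).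

Definition elt (K : 'I_(nelt T)) : set (R * R) := hull (@node R T) (vtx K).

(* [vtx K] indexes exactly the extreme points of [elt K]. *)
Definition convex_polygon (K : 'I_(nelt T)) : Prop :=
  (elt K)° !=set0 /\
  forall i, i \in vtx K -> ~ hull (@node R T) (vtx K :\ i) (node i).

Definition edge (K : 'I_(nelt T)) (i j : 'I_(nnode T)) : Prop :=
  [/\ i != j, i \in vtx K, j \in vtx K &
      hull (@node R T) [set i; j] `&` (elt K)° = set0].

(* Two distinct elements are disjoint, or meet exactly in a common vertex, or
   meet exactly in a common edge. *)
Definition conforming : Prop :=
  forall K K' : 'I_(nelt T), K != K' ->
    [\/ elt K `&` elt K' = set0,
        exists i, [/\ i \in vtx K, i \in vtx K' &
                      elt K `&` elt K' = [set node i]] |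
        exists i j, [/\ edge K i j, edge K' i j &
                      elt K `&` elt K' = hull (@node R T) [set i; j]]].

Definition conforming_partition : Prop :=
  [/\ injective (@node R T) /\ (forall i, exists K : 'I_(nelt T), i \in vtx K),
      forall K, convex_polygon K,
      forall K, (elt K)° `<=` Omega,
      closure Omega = \bigcup_(K in [set: 'I_(nelt T)]) elt K &
      conforming].

Definition P1 : set (R * R -> R) :=
  [set p | exists a b c, forall x, p x = a + b * x.1 + c * x.2].

(* A discontinuous piecewise affine function is given by its restrictions to
   the elements, [psi K] being extended from [elt K] to an affine function on
   the plane. *)
Definition dg : Type := 'I_(nelt T) -> R * R -> R.

(* The function on [Omega] with restrictions [psi K]; setting it to 0 on the
   null set formed by the element boundaries chooses a representative. *)
Definition dgfun (psi : dg) (x : R * R) : R :=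
  \sum_(K < nelt T) \1_((elt K)°) x * psi K x.

(* Square integrability over [Omega] is automatic for piecewise affine
   functions. *)
Definition Vh : set dg := [set psi | forall K, P1 (psi K)].

Definition Vh_tilde : set dg := [set psi | Vh psi /\ H1 Omega (dgfun psi)].

Definition lagrange_basis (phi : 'I_(nnode T) -> dg) : Prop :=
  (forall i j K, elt K (node j) -> phi i K (node j) = (i == j)%:R) /\
  Vh_tilde = [set psi | exists c : 'I_(nnode T) -> R,
                psi = fun K x => \sum_i c i * phi i K x].

Definition area (K : 'I_(nelt T)) : R := fine (leb2 R (elt K)).

Definition mean (psi : dg) (K : 'I_(nelt T)) : R :=
  (area K)^-1 * \int[leb2 R]_(x in elt K) psi K x.

Definition alpha (psimin psimax : R) (psi : dg) (K : 'I_(nelt T)) : R :=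
  \big[Num.min/1]_(i in vtx K | psi K (node i) != mean psi K)
    Num.min `|(mean psi K - psimin) / (mean psi K - psi K (node i))|
            `|(mean psi K - psimax) / (mean psi K - psi K (node i))|.

Definition scaling_limiter (psimin psimax : R) (psi : dg) : dg :=
  fun K x => alpha psimin psimax psi K * (psi K x - mean psi K) + mean psi K.

Definition ml_product (f g : dg) : R :=
  \sum_(K < nelt T) area K / #|vtx K|%:R *
    \sum_(i : 'I_(nnode T) | `[< elt K (node i) >]) f K (node i) * g K (node i).

Definition is_ml_projection (psi u : dg) : Prop :=
  Vh_tilde u /\ forall w, Vh_tilde w -> ml_product psi w = ml_product u w.

Definition Linfty_norm (psi : dg) : \bar R :=
  'N[leb2 R]_+oo[EFin \o dgfun psi].

End Mesh.

(* Main.v *)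
(** In the Lagrange basis the mass-lumped product is diagonal, with positive
    weights |K| / C_K, so the projection of f exists, is unique, and has as its
    j-th nodal value the weighted average of the values f|_K(x_j) over the
    elements K containing x_j.  The limiter puts the vertex values of each
    element in [-1, 1], hence by convexity all its values there; averaging
    preserves this bound, and so does affine interpolation from the vertices. *)
Require Import Defs.
From mathcomp Require Import all_boot all_order all_algebra.
From mathcomp Require Import all_classical all_reals all_analysis.
From mathcomp Require Import ring lra.

Set Implicit Arguments.
Unset Strict Implicit.
Unset Printing Implicit Defensive.

Import Order.TTheory GRing.Theory Num.Theory.
Import numFieldNormedType.Exports.
Local Open Scope ring_scope.

(* The monotonicity of a measure requires measurability, whereas the integral of
   a nonnegative function is a supremum over simple functions, so measurability
   of the sections is enough. *)
Lemma le_leb2 (R : realType) (A B : set (R * R)) :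
  (forall x, measurable (xsection A x : set (measurableTypeR R))) ->
  (forall x, measurable (xsection B x : set (measurableTypeR R))) ->
  (A `<=` B)%classic -> (leb2 R A <= leb2 R B)%E.
Proof.
move=> mA mB AB; rewrite /leb2 /= /product_measure1 !ge0_integralTE//.
apply: ge_ereal_sup => _ [h /= hA <-]; apply: ereal_sup_ubound => /=.
exists h => // x; apply: le_trans (hA x) _; apply: le_measure.
- by rewrite inE; exact: mA.
- by rewrite inE; exact: mB.
- by move=> y; rewrite !xsectionE; exact: AB.
Qed.

Lemma leb2X (R : realType) (A B : set (measurableTypeR R)) :
  measurable A -> measurable B ->
  leb2 R (A `*` B)%classic = (lebesgue_measure A * lebesgue_measure B)%E.
Proof. exact: product_measure1E. Qed.

(** * Convex hulls of finitely many points: affine bounds and area *)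

Section Hull.
Variables (R : realType) (N : nat) (x : 'I_N -> R * R).
Implicit Types V : {set 'I_N}.

Lemma hull_node V i : i \in V -> hull x V (x i).
Proof.
move=> iV; exists (fun j => (j == i)%:R); split=> [j|| ].
- exact: ler0n.
- by rewrite (bigD1 i)//= eqxx big1 ?addr0// => j /andP[_ /negbTE->].
- have E f : \sum_(j in V) (j == i)%:R * f j = f i :> R.
    rewrite (bigD1 i)//= eqxx mul1r big1 ?addr0// => j /andP[_ /negbTE->].
    by rewrite mul0r.
  by rewrite !E -surjective_pairing.
Qed.

(** An affine function commutes with convex combinations, so its value at a point of the hull is a
    weighted average of its values at the generating points. *)
Lemma hull_le V (p : R * R -> R) (M : R) y :
  P1 p -> (forall i, i \in V -> `|p (x i)| <= M) -> hull x V y -> `|p y| <= M.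
Proof.
move=> [a [b [c pE]]] pM [t [t0 t1 ->]].
have -> : p (\sum_(i in V) t i * (x i).1, \sum_(i in V) t i * (x i).2) =
    \sum_(i in V) t i * p (x i).
  rewrite pE/= -[a]mulr1 -t1 !mulr_sumr -!big_split/=.
  by apply: eq_bigr => i _; rewrite pE; ring.
rewrite -[M]mul1r -t1 mulr_suml (le_trans (ler_norm_sum _ _ _))//.
apply: ler_sum => i iV; rewrite normrM ger0_norm// ler_wpM2l//; exact: pM.
Qed.

(** A vertical section of a convex set is convex, and a convex subset of the line is an interval. *)
Lemma measurable_xsection_hull V a :
  measurable (xsection (hull x V) a : set (measurableTypeR R)).
Proof.
rewrite xsectionE.
suff : @is_interval R (fun y => hull x V (a, y)).
  exact: measurable_realfun.is_interval_measurable.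
move=> y1 y2 [t [t0 t1 [ta ty]]] [s [s0 s1 [sa sy]]] z /andP[y1z zy2].
have [y12|y12] := eqVneq y1 y2.
  have -> : z = y1 by apply/le_anti; rewrite y1z y12 zy2.
  by exists t; split => //; congr pair.
have d0 : 0 < y2 - y1 by rewrite subr_gt0 lt_neqAle y12 (le_trans y1z).
(* [z] divides the segment from [y1] to [y2] in the ratio [l]; mixing the weights [t] and [s] in
   that ratio exhibits [(a, z)] as a point of the hull. *)
pose l := (z - y1) / (y2 - y1).
have l0 : 0 <= l by rewrite divr_ge0//; lra.
have l1 : l <= 1 by rewrite ler_pdivrMr//; lra.
have comb (u v : R) f : u = \sum_(i in V) t i * f i ->
    v = \sum_(i in V) s i * f i ->
    (1 - l) * u + l * v = \sum_(i in V) ((1 - l) * t i + l * s i) * f i.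
  move=> -> ->; rewrite !mulr_sumr -big_split/=.
  by apply: eq_bigr => i _; ring.
exists (fun i => (1 - l) * t i + l * s i); split.
- by move=> i; rewrite addr_ge0// mulr_ge0// subr_ge0.
- by rewrite big_split/= -!mulr_sumr t1 s1; ring.
- rewrite -(comb _ _ _ ta sa) -(comb _ _ _ ty sy); congr pair; first by ring.
  by rewrite /l; field; rewrite gt_eqF.
Qed.

(** The hull lies in a bounded square. Finiteness matters because [fine] sends an infinite measure
    to 0, which would spoil the positivity of [area]. *)
Lemma leb2_hull_lty V : (leb2 R (hull x V) < +oo)%E.
Proof.
pose M : R := \sum_(i in V) (`|(x i).1| + `|(x i).2|).
have xM i : i \in V -> `|(x i).1| + `|(x i).2| <= M.
  by move=> iV; rewrite /M (bigD1 i)//= lerDl sumr_ge0.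
pose I : set (measurableTypeR R) := `[- M, M]%classic.
have mI : measurable I by exact: measurable_itv.
have HI : (hull x V `<=` I `*` I)%classic.
  move=> y hy; split; rewrite /I/= in_itv/= -ler_norml.
  - apply: (@hull_le V (fun y => y.1) M y) => //.
      by exists 0, 1, 0 => z; ring.
    by move=> i /xM; apply: le_trans; rewrite lerDl.
  - apply: (@hull_le V (fun y => y.2) M y) => //.
      by exists 0, 0, 1 => z; ring.
    by move=> i /xM; apply: le_trans; rewrite lerDr.
apply: (@le_lt_trans _ _ (leb2 R (I `*` I)%classic)).
  apply: le_leb2 => //; first exact: measurable_xsection_hull.
  by move=> a; exact: measurable_xsection (measurableX mI mI).
rewrite leb2X// lte_mul_pinfty//.
- by rewrite lebesgue_measure_itv/=; case: ifP; rewrite -?EFinD.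
- by rewrite lebesgue_measure_itv/=; case: ifP; rewrite -?EFinD ?ltry.
Qed.

Lemma leb2_hull_gt0 V : ((hull x V)° !=set0)%classic -> (0 < leb2 R (hull x V))%E.
Proof.
move=> [p /nbhs_ballP[e /= e0 pe]].
(* A ball of the product norm is a product of two balls of the same radius, so its measure is
   explicit. *)
pose A : set (measurableTypeR R) := ball p.1 e.
pose B : set (measurableTypeR R) := ball p.2 e.
have mA : measurable A by exact: measurable_realfun.measurable_ball.
have mB : measurable B by exact: measurable_realfun.measurable_ball.
apply: (@lt_le_trans _ _ (leb2 R (A `*` B)%classic)); last first.
  apply: le_leb2.
  - by move=> a; exact: measurable_xsection (measurableX mA mB).
  - exact: measurable_xsection_hull.
  - by move=> y [Ay By]; apply: pe.
rewrite leb2X// !lebesgue_measure_ball ?ltW//.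
by rewrite -EFinM lte_fin mulr_gt0// pmulrn_lgt0.
Qed.

End Hull.

(** * Mesh elements and the sup norm *)

Lemma ball_ne (R : realType) (p : R * R) (e : R) : 0 < e ->
  exists2 q, ball p e q & q != p.
Proof.
move=> e0; exists (p.1 + e / 2, p.2).
  by split; rewrite /ball/= ?subrr ?normr0// opprD addNKr normrN gtr0_norm; lra.
by apply/eqP => /(congr1 fst) /=; lra.
Qed.

Section Mesh.
Variables (R : realType) (Omega : set (R * R)) (T : mesh R).
Hypothesis mesh_T : conforming_partition Omega T.
Implicit Types (K : 'I_(nelt T)) (psi f u : dg T).

Lemma area_gt0 K : 0 < area K.
Proof.
have [_ /(_ K)[+ _] _ _ _] := mesh_T; rewrite /area => K0.
by rewrite fine_gt0// leb2_hull_gt0//= leb2_hull_lty.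
Qed.

Lemma card_vtx_gt0 K : (0 < #|vtx K|)%N.
Proof.
have [_ /(_ K)[[y /interior_subset[t [_ + _]]] _] _ _ _] := mesh_T.
case: (posnP #|vtx K|) => // /eqP; rewrite cards_eq0 => /eqP ->.
by rewrite big_set0 => /eqP; rewrite eq_sym oner_eq0.
Qed.

(** A common vertex would be an open singleton, which the plane does not have; a common edge misses
    the interior of each element by the definition of [edge]. *)
Lemma interior_elt_disjoint K K' : K != K' ->
  ((elt K)° `&` (elt K')° = set0)%classic.
Proof.
have [_ _ _ _ conf] := mesh_T.
move=> /conf KK'; apply/seteqP; split => // y [yK yK'].
have yKK' : (elt K `&` elt K')%classic y.
  by split; exact: interior_subset.
case: KK' => [E|[i [_ _ E]]|[i [j [[_ _ _ E'] _ E]]]].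
- by rewrite E in yKK'.
- have : nbhs y (elt K `&` elt K')%classic by exact: filterI.
  rewrite E => /nbhs_ballP[e /= e0 ye].
  have [q /ye qi] := ball_ne y e0.
  rewrite E in yKK'.
  by rewrite qi yKK' eqxx.
- by rewrite -E'; split => //; rewrite -E.
Qed.

(** At most one indicator in the sum is nonzero at a given point. Where all vanish, the value is 0
    and the bound is [M0]. *)
Lemma dgfun_le u M : 0 <= M -> (forall K x, elt K x -> `|u K x| <= M) ->
  forall x, `|dgfun u x| <= M.
Proof.
move=> M0 uM x; rewrite /dgfun.
have [[K Kx]|nx] := pselect (exists K : 'I_(nelt T), ((elt K)°)%classic x).
  rewrite (bigD1 K)//= indicE mem_set//= mul1r big1 ?addr0.
    by apply: uM; exact: interior_subset.
  move=> K' K'K; rewrite indicE memNset ?mul0r// => K'x.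
  have : ((elt K')° `&` (elt K)°)%classic x by [].
  by rewrite interior_elt_disjoint.
rewrite big1 ?normr0// => K _; rewrite indicE memNset ?mul0r// => Kx.
by apply: nx; exists K.
Qed.

Lemma Linfty_norm_le u M : 0 <= M -> (forall K x, elt K x -> `|u K x| <= M) ->
  (Linfty_norm u <= M%:E)%E.
Proof.
(* The norm is 0 by convention when the whole space is null; that case is settled by [M0]. *)
move=> M0 uM; rewrite /Linfty_norm unlock; case: ifP => // _.
apply/ess_sup_inf.ess_supP; apply: nearW => x /=.
by rewrite lee_fin dgfun_le.
Qed.

(** * The scaling limiter *)

Lemma scaling_limiter_P1 a b psi K : P1 (psi K) ->
  P1 (scaling_limiter a b psi K).
Proof.
move=> [a0 [b0 [c0 E]]]; pose al := alpha a b psi K.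
exists (al * (a0 - mean psi K) + mean psi K), (al * b0), (al * c0) => x.
by rewrite /scaling_limiter E -/al; ring.
Qed.

(** With [m] the mean and [z] the vertex value, the choice of [alpha] makes [alpha * |m - z|] at
    most both [m - a] and [b - m], so the limited value stays within the nearer bound. *)
Lemma scaling_limiter_vtx a b psi K i : a <= mean psi K <= b -> i \in vtx K ->
  a <= scaling_limiter a b psi K (node i) <= b.
Proof.
move=> /andP[am mb] iK; rewrite /scaling_limiter.
set m := mean psi K in am mb *; set z := psi K (node i).
(* The minimum skips such a vertex, but its limited value is the mean itself. *)
have [->|zm] := eqVneq z m; first by rewrite subrr mulr0 add0r am mb.
have a0 : 0 <= alpha a b psi K.
  by apply: le_bigmin => // j _; rewrite le_min !normr_ge0.
have : alpha a b psi K <= Num.min `|(m - a) / (m - z)| `|(m - b) / (m - z)|.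
  by rewrite /alpha; apply: bigmin_le_cond; rewrite iK.
have mz0 : 0 < `|m - z| by rewrite normr_gt0 subr_eq0 eq_sym.
rewrite le_min !normrM !normfV !ler_pdivlMr// => /andP[].
rewrite (ger0_norm (x := m - a)) ?subr_ge0// (ler0_norm (x := m - b)) ?subr_le0//.
have -> : alpha a b psi K * `|m - z| = `|alpha a b psi K * (m - z)|.
  by rewrite normrM (ger0_norm a0).
rewrite !ler_norml => /andP[? ?] /andP[? ?]; apply/andP; split; lra.
Qed.

(** The bound is stated on the whole element because the lumped product evaluates at every node
    lying in [elt K]. *)
Lemma scaling_limiter_le1 psi K x : P1 (psi K) -> -1 <= mean psi K <= 1 ->
  elt K x -> `|scaling_limiter (-1) 1 psi K x| <= 1.
Proof.
move=> psiP m1; apply: hull_le; first exact: scaling_limiter_P1.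
by move=> i iK; rewrite ler_norml scaling_limiter_vtx.
Qed.

(** * The mass-lumped projection *)

(** The diagonal entry of the lumped mass matrix at node [j]. *)
Definition ml_mass (j : 'I_(nnode T)) : R :=
  \sum_(K < nelt T | `[< elt K (node j) >]) area K / #|vtx K|%:R.

Definition ml_coef f (j : 'I_(nnode T)) : R :=
  (ml_mass j)^-1 * \sum_(K < nelt T | `[< elt K (node j) >])
    area K / #|vtx K|%:R * f K (node j).

Lemma ml_weight_gt0 K : 0 < area K / #|vtx K|%:R.
Proof. by rewrite divr_gt0 ?area_gt0// ltr0n card_vtx_gt0. Qed.

Lemma ml_mass_gt0 j : 0 < ml_mass j.
Proof.
have [[_ /(_ j)[K jK]] _ _ _ _] := mesh_T.
rewrite /ml_mass (bigD1 K)/=; last exact/asboolP/hull_node.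
by rewrite ltr_wpDr ?ml_weight_gt0// sumr_ge0// => K' _; rewrite ltW ?ml_weight_gt0.
Qed.

Lemma ml_coef_le f M j : (forall K x, elt K x -> `|f K x| <= M) ->
  `|ml_coef f j| <= M.
Proof.
move=> fM; have m0 := ml_mass_gt0 j.
rewrite /ml_coef normrM normfV (gtr0_norm m0) mulrC ler_pdivrMr//.
rewrite (le_trans (ler_norm_sum _ _ _))// mulr_sumr ler_sum// => K /asboolP jK.
rewrite normrM (gtr0_norm (ml_weight_gt0 K)) mulrC ler_wpM2r ?fM//.
exact/ltW/ml_weight_gt0.
Qed.

Section Basis.
Variable phi : 'I_(nnode T) -> dg T.
Hypothesis basis_phi : lagrange_basis Omega phi.

Definition interpolant (c : 'I_(nnode T) -> R) : dg T :=
  fun K x => \sum_i c i * phi i K x.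

Lemma Vh_tildeP u : Vh_tilde Omega u <-> exists c, u = interpolant c.
Proof. by rewrite basis_phi.2. Qed.

Lemma interpolant_node c K j : elt K (node j) -> interpolant c K (node j) = c j.
Proof.
move=> jK; rewrite /interpolant (bigD1 j)//= basis_phi.1// eqxx mulr1.
by rewrite big1 ?addr0// => i ij; rewrite basis_phi.1// (negbTE ij) mulr0.
Qed.

Lemma interpolant_delta j : interpolant (fun i => (i == j)%:R) = phi j.
Proof.
apply/funext => K; apply/funext => x; rewrite /interpolant (bigD1 j)//= eqxx mul1r.
by rewrite big1 ?addr0// => i /negbTE->; rewrite mul0r.
Qed.

(** Exchanging the sums over elements and nodes collects the contributions of each node. *)
Lemma ml_product_interpolant f w :
  ml_product f (interpolant w) = \sum_j w j * (ml_mass j * ml_coef f j).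
Proof.
rewrite /ml_product.
under eq_bigr do rewrite mulr_sumr big_mkcond.
rewrite exchange_big/=; apply: eq_bigr => j _.
rewrite /ml_coef mulVKf ?gt_eqF ?ml_mass_gt0//.
rewrite mulr_sumr [RHS]big_mkcond; apply: eq_bigr => K _.
case: asboolP => // jK; rewrite interpolant_node//; ring.
Qed.

Lemma ml_coef_interpolant c : ml_coef (interpolant c) = c.
Proof.
apply/funext => j; rewrite /ml_coef.
under eq_bigr => K /asboolP jK do rewrite interpolant_node//.
by rewrite -mulr_suml mulrA mulVf ?mul1r// gt_eqF ?ml_mass_gt0.
Qed.

Lemma is_ml_projectionP f u :
  is_ml_projection Omega f u <-> u = interpolant (ml_coef f).
Proof.
split=> [[/Vh_tildeP[c ->] fu]|->].
  congr interpolant; apply/funext => j.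
  (* Testing against [phi j] isolates the [j]-th coefficient, and the positive mass cancels. *)
  have := fu (phi j); rewrite -interpolant_delta => /(_ _)/wrap[].
    by apply/Vh_tildeP; eexists.
  have E g : \sum_i (i == j)%:R * g i = g j :> R.
    by rewrite (bigD1 j)//= eqxx mul1r big1 ?addr0// => i /negbTE->; rewrite mul0r.
  rewrite !ml_product_interpolant ml_coef_interpolant !E.
  by move/mulfI->; rewrite // gt_eqF ?ml_mass_gt0.
split; first by apply/Vh_tildeP; eexists.
by move=> w /Vh_tildeP[c ->]; rewrite !ml_product_interpolant ml_coef_interpolant.
Qed.

Lemma interpolant_le c M : (forall i, `|c i| <= M) ->
  forall K x, elt K x -> `|interpolant c K x| <= M.
Proof.
move=> cM K x; apply: hull_le.
  (* Affinity on each element comes from the span of the basis being [Vh_tilde]. *)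
  have : Vh_tilde Omega (interpolant c) by apply/Vh_tildeP; eexists.
  by case=> /(_ K).
by move=> i iK; rewrite interpolant_node//; exact: hull_node.
Qed.

End Basis.
End Mesh.

Theorem corollary3p6p1 (R : realType) (Omega : set (R * R)) (T : mesh R)
    (phi : 'I_(nnode T) -> dg T) (psi : dg T)
    (domain_Omega : domain Omega)
    (mesh_T : conforming_partition Omega T)
    (basis_phi : lagrange_basis Omega phi)
    (psi_Vh_tilde : Vh_tilde Omega psi)
    (mean_psi : forall K, -1 <= mean psi K <= 1) :
  (exists! u, is_ml_projection Omega (scaling_limiter (-1) 1 psi) u) /\
  (forall u, is_ml_projection Omega (scaling_limiter (-1) 1 psi) u ->
     (Linfty_norm u <= 1)%E).
Proof.
have projP := is_ml_projectionP mesh_T basis_phi (scaling_limiter (-1) 1 psi).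
split.
  exists (interpolant phi (ml_coef (scaling_limiter (-1) 1 psi))).
  by split=> [|u /projP]; first exact/projP.
move=> u /projP ->; apply: (Linfty_norm_le mesh_T) => //.
apply: (interpolant_le basis_phi) => i; apply: (ml_coef_le mesh_T) => K x.
by apply: scaling_limiter_le1 => //; exact: psi_Vh_tilde.1.
Qed.
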